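(* Let $p$ be an odd prime and let $K$, $L$, $M$, $N$ be integers with $0\le K<K+M<p$ and $0\le L<L+N<p$, and suppose $N^2\ge M\ge N^{1/2}$. For positive integers $r$ and an integer $\lambda$, let $T_r(K,M;L,N;\lambda)$ be the number of tuples of integers $(m_1,\ldots,m_r,n_1,\ldots,n_r)$ with $K+1\le m_1,\ldots,m_r\le K+M$ and $L+1\le n_1,\ldots,n_r\le L+N$ satisfying $$\sum_{i=1}^{r} n_i!\,m_i!\equiv \lambda\pmod p.$$ Then for any positive integers $k$, $\ell$, $r$, $s$ with $s\le r/2$, $$\left|T_r(K,M;L,N;\lambda)-\frac{(MN)^r}{p}\right|\ll M^{\,r-1+\frac{1}{2s}-\frac{r-2s}{2\ell(k+1)}}\;N^{\,r-\frac{1}{2(s+1)}-\frac{r-2s}{2k(\ell+1)}}\;p^{\frac{r-2s}{2k\ell}}.$$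
   Context: The notation $U\ll V$ means $|U|\le cV$ for some constant $c>0$; here $c$ may depend on $k,\ell,r,s$ only (not on $p$, $K$, $L$, $M$, $N$, $\lambda$). *)

(* Defs.v *)
From mathcomp Require Import all_boot all_order all_algebra.
From mathcomp Require Import reals exp.

Set Implicit Arguments.
Unset Strict Implicit.
Unset Printing Implicit Defensive.

Import Order.TTheory GRing.Theory Num.Theory.

Local Open Scope ring_scope.

(* The pair (mm, nn) consists of the tuples (m_1, ..., m_r) and
   (n_1, ..., n_r). The ordinal types only bound the entries from above, by
   K + M and L + N; the lower bounds are imposed in the comprehension. *)
Definition factorial_sum_count (p r K M L N : nat) (lambda : int) : nat :=
  #|[set t : {ffun 'I_r -> 'I_(K + M).+1} * {ffun 'I_r -> 'I_(L + N).+1} |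
      let: (mm, nn) := t in
      [&& [forall i, K + 1 <= mm i]%N,
          [forall i, L + 1 <= nn i]%N
        & (\sum_(i < r) ((nn i)`! * (mm i)`!)%N%:Z == lambda %[mod p])%Z]]|.

(* Main.v *)
Require Import Defs.
From mathcomp Require Import all_boot all_order all_algebra all_field.
From mathcomp Require Import reals exp ring lra zify.

Import Order.TTheory GRing.Theory Num.Theory.

(* Write S(a) for the sum of e(a m! n! / p) over the box of pairs (m, n).
   Orthogonality of characters bounds the deviation by
   (max_{a <> 0} |S(a)|)^(r - 2 s) E_s, where E_s = p^-1 sum_a |S(a)|^(2 s) is
   an additive energy.

   Hoelder's inequality, applied to each of the two variables, bounds |S(a)| by
   the energies J_k, J_l of the single sequences m! and n!.

   Energies are bounded by averaging over shifts m -> m + h with h < H: since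
   (m + h)! = m! f_h(m) with f_h monic of degree h, dividing by m! leaves, for
   fixed h_i and n_i, the polynomial equation sum_i +- f_{h_i}(m) n_i! = 0 in m,
   which has fewer than H solutions unless sum_{i : h_i = h} +- n_i! = 0 for each
   h. No fibre {i : h_i = h} of such an exceptional tuple is a singleton, and
   log-convexity of the moments of the exponential sum (as in Rosenthal's
   inequality) bounds their number by
   sum_j H^j E_1^(j-1) E_{s-j+1}, with energies of the sequence n!. For
   constant n! this gives J_s << M^(2s-1+1/(s+1)) with H = M^(1/(s+1)); feeding
   this back gives
   E_s << M^(2s-1+1/(2s)) N^(2s-1/(2(s+1))) with
   H = max(1, M^(1/(2s)) N^(-1/(2(s+1)))). *)

Local Open Scope ring_scope.

(** * Power means *)

Section PowerMeans.
Variables (R : numDomainType) (I : finType).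
Implicit Types w x y f g : I -> R.

Lemma double_sum_mul f g : (\sum_i f i) * (\sum_i g i) *+ 2 =
    \sum_i \sum_j (f i * g j + f j * g i).
Proof.
under [RHS]eq_bigr => i _ do rewrite big_split /=.
rewrite big_split /= mulr2n [X in _ = _ + X]exchange_big /=.
by rewrite !big_distrl /=; congr (_ + _); apply: eq_bigr => i _; rewrite big_distrr.
Qed.

(** Symmetrising in [i] and [j] leaves terms [w i * w j] times two differences of powers, which have
    the same sign. *)
Lemma chebyshev_sum w x (a b : nat) :
  (forall i, 0 <= w i) -> (forall i, 0 <= x i) ->
  (\sum_i w i * x i ^+ a) * (\sum_i w i * x i ^+ b) <=
  (\sum_i w i) * (\sum_i w i * x i ^+ (a + b)).
Proof.
move=> w0 x0.
rewrite -(ler_pMn2r (n := 2)) // -subr_ge0 !double_sum_mul -sumrB.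
apply: sumr_ge0 => i _; rewrite -sumrB; apply: sumr_ge0 => j _.
have -> : w i * (w j * x j ^+ (a + b)) + w j * (w i * x i ^+ (a + b)) -
    (w i * x i ^+ a * (w j * x j ^+ b) + w j * x j ^+ a * (w i * x i ^+ b)) =
    w i * w j * ((x i ^+ a - x j ^+ a) * (x i ^+ b - x j ^+ b)).
  by rewrite !exprD; ring.
apply: mulr_ge0; first exact: mulr_ge0.
case/orP: (ger_leVge (x0 i) (x0 j)) => le_x.
  by apply: mulr_le0; rewrite subr_le0 lerXn2r ?nnegrE.
by apply: mulr_ge0; rewrite subr_ge0 lerXn2r ?nnegrE.
Qed.

(** A form of Hoelder's inequality, by induction from Chebyshev's inequality with exponents [1] and
    [k.+1]. *)
Lemma weighted_power_mean w x k :
  (forall i, 0 <= w i) -> (forall i, 0 <= x i) ->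
  (\sum_i w i * x i) ^+ k.+1 <= (\sum_i w i) ^+ k * (\sum_i w i * x i ^+ k.+1).
Proof.
move=> w0 x0; elim: k => [|k IHk]; first by rewrite mul1r.
have s0 n : 0 <= \sum_i w i * x i ^+ n.
  by apply: sumr_ge0 => i _; rewrite mulr_ge0 ?exprn_ge0.
rewrite exprS; apply: le_trans (ler_wpM2l (s0 1%N) IHk) _.
rewrite mulrCA exprSr -mulrA ler_wpM2l ?exprn_ge0 ?sumr_ge0 //.
exact: (@chebyshev_sum w x 1 k.+1).
Qed.

Lemma power_mean x k : (forall i, 0 <= x i) ->
  (\sum_i x i) ^+ k.+1 <= #|I|%:R ^+ k * (\sum_i x i ^+ k.+1).
Proof.
move=> x0; have := @weighted_power_mean (fun=> 1) x k (fun=> ler01) x0.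
rewrite sumr_const; under eq_bigr do rewrite mul1r.
by under [X in _ <= _ * X]eq_bigr do rewrite mul1r.
Qed.

(** Lagrange's identity. Nonnegativity makes the entries real: over a [numDomainType] such as [algC]
    squares of other elements can be negative. *)
Lemma cauchy_schwarz_sum x y : (forall i, 0 <= x i) -> (forall i, 0 <= y i) ->
  (\sum_i x i * y i) ^+ 2 <= (\sum_i x i ^+ 2) * (\sum_i y i ^+ 2).
Proof.
move=> x0 y0.
rewrite expr2 -(ler_pMn2r (n := 2)) // -subr_ge0 !double_sum_mul -sumrB.
apply: sumr_ge0 => i _; rewrite -sumrB; apply: sumr_ge0 => j _.
have -> : x i ^+ 2 * y j ^+ 2 + x j ^+ 2 * y i ^+ 2 -
    (x i * y i * (x j * y j) + x j * y j * (x i * y i)) =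
    (x i * y j - x j * y i) ^+ 2 by ring.
by apply: real_exprn_even_ge0; rewrite // rpredB // ger0_real ?mulr_ge0.
Qed.

End PowerMeans.

(** * Additive characters and additive energy *)

(** The third clause is orthogonality; at [c = 1] it forces [e] to be nontrivial. *)
Definition nontrivial_character {F : finFieldType} (e : F -> algC) : Prop :=
  [/\ {morph e : x y / x + y >-> x * y}, forall x, `|e x| = 1
    & forall c, \sum_x e (x * c) = #|F|%:R * (c == 0)%:R].

Lemma exists_nontrivial_character (p : nat) : prime p ->
  exists e : 'F_p -> algC, nontrivial_character e.
Proof.
move=> pr_p; have p_gt0 := prime_gt0 pr_p.
have [z z_prim] := C_prim_root_exists p_gt0.
have zp : z ^+ p = 1 by exact: prim_expr_order.
have nz : `|z| = 1.
  by apply/eqP; rewrite -(pexpr_eq1 p_gt0) ?normr_ge0 // -normrX zp normr1.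
pose e (x : 'F_p) := z ^+ (x : nat).
have eM : {morph e : x y / x + y >-> x * y}.
  move=> x y; rewrite /e -exprD -(prim_expr_mod z_prim (x + y)%N).
  by congr (_ ^+ _); congr (_ %% _)%N; exact: Fp_cast.
exists e; split=> // [x|c]; first by rewrite /e normrX nz expr1n.
have e0 : e 0 = 1 by rewrite /e expr0.
have [->|c_neq0] := eqVneq c 0.
  by under eq_bigr do rewrite mulr0 e0; rewrite sumr_const mulr1.
rewrite mulr0.
have eN1 : e 1 != 1.
  rewrite /e -(prim_order_dvd z_prim).
  by rewrite (_ : nat_of_ord _ = 1%N) // dvdn1 neq_ltn prime_gt1 ?orbT.
set S := \sum_x _.
(* Translating [x] by [c^-1] multiplies the sum by [e 1], which is not 1, so the sum vanishes. *)
have : e 1 * S = S.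
  rewrite /S big_distrr /= [RHS](reindex_inj (addIr c^-1)) /=.
  apply: eq_bigr => x _; rewrite -eM mulrDl mulVf // addrC //.
move/eqP; rewrite -subr_eq0 -{2}[S]mul1r -mulrBl mulf_eq0 subr_eq0 (negPf eN1) /=.
by move/eqP.
Qed.

Definition expsum {F : finFieldType} (e : F -> algC) {I : finType} (u : I -> F) (a : F) :
  algC := \sum_i e (a * u i).

Definition sg {F : finFieldType} {k : nat} (t : bool * 'I_k) : F := if t.1 then -1 else 1.

(* The number of solutions of u(x_1) + ... + u(x_k) = u(y_1) + ... + u(y_k); the
   boolean separates the two sides of the equation. *)
Definition energy {F : finFieldType} (k : nat) {I : finType} (u : I -> F) : nat :=
  #|[set f : {ffun bool * 'I_k -> I} | \sum_t sg t * u (f t) == 0]|.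

Section ExponentialSums.
Variables (F : finFieldType) (e : F -> algC).
Hypothesis e_char : nontrivial_character e.

Lemma charD : {morph e : x y / x + y >-> x * y}. Proof. by case: e_char. Qed.
Lemma norm_char x : `|e x| = 1. Proof. by case: e_char. Qed.
Lemma sum_char c : \sum_x e (x * c) = #|F|%:R * (c == 0)%:R.
Proof. by case: e_char. Qed.

Lemma char_neq0 x : e x != 0. Proof. by rewrite -normr_eq0 norm_char oner_eq0. Qed.

Lemma char0 : e 0 = 1.
Proof. by apply: (mulfI (char_neq0 0)); rewrite -charD addr0 mulr1. Qed.

Lemma charN x : e (- x) = (e x)^*.
Proof.
apply: (mulfI (char_neq0 x)).
by rewrite -charD subrr char0 -normCK norm_char expr1n.
Qed.

Lemma char_sum (T : finType) (f : T -> F) : e (\sum_t f t) = \prod_t e (f t).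
Proof. exact: (big_morph e charD char0). Qed.

Lemma card_field_gt0 : (0 : algC) < #|F|%:R.
Proof. by rewrite ltr0n; apply/card_gt0P; exists 0. Qed.

Lemma expsumN (I : finType) (u : I -> F) a : expsum e u (- a) = (expsum e u a)^*.
Proof. by rewrite /expsum rmorph_sum /=; apply: eq_bigr => i _; rewrite mulNr charN. Qed.

(** Expanding the product gives a sum over functions [f]; orthogonality in [a] keeps those solving
    the equation. *)
Lemma sum_prod_weighted_expsum (T I : finType) (c : T -> F) (u : I -> F)
    (th : T -> I -> algC) :
  \sum_a \prod_t \sum_i th t i * e (a * (c t * u i)) =
  #|F|%:R * \sum_(f : {ffun T -> I} | \sum_t c t * u (f t) == 0) \prod_t th t (f t).
Proof.
under eq_bigr do rewrite bigA_distr_bigA /=.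
rewrite exchange_big [in RHS]big_mkcond big_distrr /=; apply: eq_bigr => f _.
under eq_bigr do rewrite big_split /= -char_sum -big_distrr /=.
rewrite -big_distrr /= sum_char; case: ifP => _; last by rewrite !mulr0.
by rewrite mulr1 mulrC.
Qed.

Lemma norm_exprD k (z : algC) :
  `|z| ^+ (k + k) = \prod_(t : bool * 'I_k) (if t.1 then z^* else z).
Proof.
rewrite -(pair_bigA _ (fun (b : bool) (_ : 'I_k) => if b then z^* else z)) /=.
rewrite big_bool /= !prodr_const !card_ord -exprMn mulrC -normCK -exprM.
by rewrite mul2n addnn.
Qed.

Lemma weighted_moment k (I : finType) (u : I -> F) (th : I -> algC) :
  \sum_a `|\sum_i th i * e (a * u i)| ^+ (k + k) =
  #|F|%:R * \sum_(f : {ffun bool * 'I_k -> I} | \sum_t sg t * u (f t) == 0)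
    \prod_t (if t.1 then (th (f t))^* else th (f t)).
Proof.
rewrite -(sum_prod_weighted_expsum _ _ sg u
  (fun t i => if t.1 then (th i)^* else th i)).
apply: eq_bigr => a _; rewrite norm_exprD; apply: eq_bigr => -[b j] _ /=.
case: b; rewrite /sg /=.
  rewrite rmorph_sum; apply: eq_bigr => i _ /=.
  by rewrite mulN1r mulrN charN; exact: rmorphM.
by apply: eq_bigr => i _; rewrite mul1r.
Qed.

Lemma moment_eq_energy k (I : finType) (u : I -> F) :
  \sum_a `|expsum e u a| ^+ (k + k) = #|F|%:R * (energy k u)%:R.
Proof.
transitivity (\sum_a `|\sum_i 1 * e (a * u i)| ^+ (k + k)).
  apply: eq_bigr => a _; congr (`|_| ^+ _).
  by apply: eq_bigr => i _; rewrite mul1r.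
rewrite (weighted_moment k I u (fun=> 1)); congr (_ * _).
rewrite /energy cardsE -sum1_card natr_sum.
by apply: eq_bigr => f _; rewrite big1 // => t _; rewrite conjC1 if_same.
Qed.

(** Each solution contributes a product of absolute value at most 1. The weights will be the phases
    in the bilinear estimate. *)
Lemma weighted_moment_le_energy k (I : finType) (u : I -> F) (th : I -> algC) :
  (forall i, `|th i| <= 1) ->
  \sum_a `|\sum_i th i * e (a * u i)| ^+ (k + k) <= #|F|%:R * (energy k u)%:R.
Proof.
move=> th1.
rewrite -[X in X <= _]ger0_norm; last by apply: sumr_ge0 => a _; rewrite exprn_ge0.
rewrite weighted_moment normrM normr_nat ler_wpM2l ?ler0n //.
apply: le_trans (ler_norm_sum _ _ _) _.
rewrite /energy cardsE -sum1_card natr_sum; apply: ler_sum => f _.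
rewrite normr_prod; apply: Num.Theory.prodr_ile1 => t _.
rewrite normr_ge0 /=; case: ifP => _; last exact: th1. rewrite norm_conjC; exact: th1.
Qed.

End ExponentialSums.

(** * Shifting the factorials *)

Definition vanishing_fibres {F : finFieldType} (s H : nat) {J : finType} (w : J -> F) :=
  [set t : {ffun bool * 'I_s -> 'I_H * J} |
    [forall h, \sum_(i | (t i).1 == h) sg i * w (t i).2 == 0]].

Section Shift.
Variables (F : finFieldType) (e : F -> algC).
Hypothesis e_char : nontrivial_character e.

(** Addition in ['I_M.+1] is cyclic, so each shift permutes it and [H] times the exponential sum is
    the sum over [m] of short sums over shifts. Hoelder over [m] finishes. *)
Lemma shift_energy_le (s M H : nat) (J : finType) (g : 'I_M.+1 -> F) (w : J -> F) :
  (0 < s)%N ->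
  (H ^ (s + s) * energy s (fun x : 'I_M.+1 * J => g x.1 * w x.2)%R <=
   M.+1 ^ (s + s).-1 *
   \sum_(m : 'I_M.+1) energy s (fun x : 'I_H * J => g (m + inZp x.1) * w x.2)%R)%N.
Proof.
move=> s_gt0; rewrite -(ler_nat algC) -(ler_pM2l (card_field_gt0 F)).
rewrite !natrM natr_sum !natrX mulrCA -(moment_eq_energy F e e_char).
rewrite mulrCA [#|F|%:R * _]big_distrr /=.
under [X in _ <= _ * X]eq_bigr do rewrite -(moment_eq_energy F e e_char).
rewrite exchange_big /= !big_distrr /=; apply: ler_sum => a _.
rewrite -[X in X ^+ _ * _]normr_nat -exprMn -normrM.
have -> : H%:R * expsum e (fun x : 'I_M.+1 * J => g x.1 * w x.2) a =
    \sum_(m : 'I_M.+1) expsum e (fun x : 'I_H * J => g (m + inZp x.1) * w x.2) a.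
  rewrite exchange_big /= /expsum.
  rewrite -(pair_bigA _ (fun (h : 'I_H) n => \sum_m e (a * (g (m + inZp h) * w n)))) /=.
  rewrite -[H in LHS]card_ord mulr_natl -sumr_const; apply: eq_bigr => h _.
  rewrite -(pair_bigA _ (fun m n => e (a * (g m * w n)))) exchange_big /=.
  by apply: eq_bigr => n _; rewrite (reindex_inj (addIr (inZp h))).
have -> : (s + s = (s + s).-1.+1)%N by rewrite prednK // addn_gt0 s_gt0.
apply: (@le_trans _ _ ((\sum_(m : 'I_M.+1)
   `|expsum e (fun x : 'I_H * J => g (m + inZp x.1) * w x.2) a|) ^+ (s + s).-1.+1)).
  by rewrite lerXn2r ?nnegrE ?sumr_ge0 ?ler_norm_sum.
by apply: le_trans (power_mean _ _ _ _ _) _ => [m|]; rewrite ?normr_ge0 ?card_ord.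
Qed.

End Shift.

(** Since [q n] has degree exactly [n], the coefficient of degree [n] isolates the last scalar. *)
Lemma staircase_free (R : idomainType) (n : nat) (q : nat -> {poly R}) (c : nat -> R) :
  (forall h, size (q h) = h.+1) -> \sum_(h < n) c h *: q h = 0 ->
  forall h, (h < n)%N -> c h = 0.
Proof.
move=> sq; elim: n => // n IHn; rewrite big_ord_recr /= => sum0.
have cn0 : c n = 0.
  have := congr1 (fun p : {poly R} => p`_n) sum0; rewrite /= coef0 coefD coef_sum big1.
    rewrite add0r coefZ => /eqP; rewrite mulf_eq0 => /orP[/eqP//|].
    have : lead_coef (q n) != 0 by rewrite lead_coef_eq0 -size_poly_eq0 sq.
    by rewrite lead_coefE sq => /negPf->.
  by move=> h _; rewrite coefZ nth_default ?mulr0 // sq.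
move=> h; rewrite ltnS leq_eqVlt => /orP[/eqP->//|]; apply: IHn.
by rewrite cn0 scale0r addr0 in sum0.
Qed.

Lemma fact_shift n h : ((n + h)`! = n`! * \prod_(i < h) (n + i.+1))%N.
Proof.
elim: h => [|h IHh]; first by rewrite addn0 big_ord0 muln1.
by rewrite big_ord_recr /= mulnA -IHh addnS factS mulnC.
Qed.

Section FactorialShift.
Variable (p : nat).
Hypothesis pr_p : prime p.
Let F := 'F_p.

Lemma natr_Fp_eq0 n : ((n%:R : F) == 0) = (p %| n)%N.
Proof. by rewrite -(dvdn_pcharf (pchar_Fp pr_p)). Qed.

Lemma natr_Fp_inj : {in [pred n | (n < p)%N] &, injective (fun n => n%:R : F)}.
Proof.
move=> m n; rewrite !inE => lt_m lt_n.
wlog le_mn : m n lt_m lt_n / (m <= n)%N.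
  by move=> W; case/orP: (leq_total m n) => le E; [|symmetry]; apply: W.
move/eqP; rewrite eq_sym -subr_eq0 -natrB // natr_Fp_eq0 => dv.
apply/eqP; rewrite eqn_leq le_mn -subn_eq0; move: dv.
by case: (n - m)%N (leq_subr m n) => // d le_d /dvdn_leq; lia.
Qed.

Lemma fact_Fp_neq0 n : (n < p)%N -> (n`!%:R : F) != 0.
Proof.
elim: n => [|n IHn] lt_n; first by rewrite oner_eq0.
rewrite factS natrM mulf_neq0 ?IHn ?(ltnW lt_n) // natr_Fp_eq0 gtnNdvd //.
Qed.

(** As a polynomial in [m] this is the quotient of [(K + m + h)!] by [(K + m)!]. *)
Definition rising (K h : nat) : {poly F} := \prod_(i < h) ('X + (K + i.+1)%:R%:P).

Lemma size_rising K h : size (rising K h) = h.+1.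
Proof.
rewrite /rising; under eq_bigr do rewrite -[_%:P]opprK -polyCN.
by rewrite size_prod_XsubC /index_enum -enumT size_enum_ord.
Qed.

Lemma horner_rising K h (m : nat) : ((K + m + h)`!%:R : F) = (K + m)`!%:R * (rising K h).[m%:R].
Proof.
rewrite fact_shift natrM; congr (_ * _).
rewrite /rising horner_prod natr_prod; apply: eq_bigr => i _.
by rewrite !hornerE -natrD; congr _%:R; lia.
Qed.

(* These are the m for which m + h may wrap around in the cyclic group 'I_M.+1. *)
Lemma card_wrapping M H : (0 < H)%N -> (#|[set m : 'I_M.+1 | (M.+1 < m + H)%N]| <= H.-1)%N.
Proof.
move=> H_gt0; rewrite cardE -(size_map val) -(size_iota (M.+2 - H)%N H.-1).
apply: uniq_leq_size => [|x]; first by rewrite (map_inj_uniq val_inj) enum_uniq.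
case/mapP => m; rewrite mem_enum inE => lt_m ->; rewrite mem_iota /=.
by have := ltn_ord m; lia.
Qed.

(** Count, for each tuple [t], the solutions [m]. A tuple with vanishing fibres may admit every [m].
    Any other admits at most [H.-1] roots of a nonzero polynomial and at most [H.-1] wrapping values
    of [m], hence the factor 2. *)
Lemma energy_sum_le (K M H s : nat) (J : finType) (w : J -> F) :
  (0 < H)%N -> (K + M < p)%N ->
  (\sum_(m : 'I_M.+1)
     energy s (fun x : 'I_H * J => ((K + (m + inZp x.1)%R)`!)%:R * w x.2)%R <=
   M.+1 * #|vanishing_fibres s H w| + 2 * H.-1 * (H * #|J|) ^ (s + s))%N.
Proof.
move=> H_gt0 lt_p.
pose T := {ffun bool * 'I_s -> 'I_H * J}.
pose v m (x : 'I_H * J) : F := ((K + (m + inZp x.1 : 'I_M.+1)%R)`!)%:R * w x.2.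
pose sol m (t : T) := \sum_i sg i * v m (t i) == 0.
have -> : (\sum_m energy s (v m) = \sum_(t : T) #|[set m | sol m t]|)%N.
  rewrite /energy; under eq_bigr do rewrite cardsE -sum1_card big_mkcond.
  rewrite exchange_big /=; apply: eq_bigr => t _.
  by rewrite cardsE -sum1_card -big_mkcond.
apply: (@leq_trans (\sum_(t : T) (M.+1 * (t \in vanishing_fibres s H w) + 2 * H.-1))%N).
  apply: leq_sum => t _; rewrite inE.
  case: forallP => [_|Nfib].
    by rewrite muln1; apply: leq_trans (leq_addr _ _); rewrite -[M.+1]card_ord max_card.
  rewrite muln0 add0n.
  pose c (h : nat) : F := \sum_(i | (t i).1 == h :> nat) sg i * w (t i).2.
  pose P := \sum_(h < H) c h *: rising K h.
  have P0 : P != 0.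
    apply/eqP => /(staircase_free _ _ _ _ (size_rising K)) c0.
    by apply: Nfib => h; apply/eqP; exact: (c0 h (ltn_ord h)).
  have sP : (size P <= H)%N.
    apply: leq_trans (size_sum _ _ _) _; apply/bigmax_leqP => h _.
    by apply: leq_trans (size_scale_leq _ _) _; rewrite size_rising.
  (* Without wraparound [(K + m)!] factors out of the equation, and it is invertible because
     [K + m < p]. *)
  have solP (m : 'I_M.+1) : (m + H <= M.+1)%N -> sol m t = root P m%:R.
    move=> le_m.
    have -> : sol m t = ((K + m)`!%:R * P.[m%:R] == 0).
      rewrite /sol; congr (_ == _); rewrite /P horner_sum big_distrr /=.
      rewrite (partition_big (fun i => (t i).1) xpredT) //=; apply: eq_bigr => h _.
      rewrite hornerZ mulrCA mulr_suml; apply: eq_bigr => i /eqP <-.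
      rewrite -mulrA; congr (_ * _); rewrite /v mulrC; congr (_ * _).
      rewrite -horner_rising; congr (_`!%:R); rewrite -addnA; congr (_ + _)%N.
      have lt_h := ltn_ord (t i).1.
      by rewrite /= (modn_small (m := (t i).1)) ?modn_small //; lia.
    rewrite mulf_eq0 (negPf (fact_Fp_neq0 _ _)) //.
    by have := ltn_ord m; lia.
  rewrite mul2n -addnn.
  apply: leq_trans (leq_add (card_wrapping M H H_gt0) (leqnn _)).
  rewrite -(cardsID [set m : 'I_M.+1 | (M.+1 < m + H)%N] [set m | sol m t]) leq_add //.
    by apply: subset_leq_card; apply: subsetIr.
  rewrite -ltnS prednK //; apply: leq_trans sP.
  rewrite cardE -(size_map (fun m : 'I_M.+1 => m%:R : F)); apply: max_poly_roots => //.
    apply/allP => x /mapP[m]; rewrite mem_enum !inE -leqNgt => /andP[le_m sol_m] ->.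
    by rewrite -solP.
  rewrite map_inj_in_uniq ?enum_uniq // => m1 m2 _ _ /natr_Fp_inj E.
  apply/val_inj/E; rewrite inE; first by have := ltn_ord m1; lia.
  by have := ltn_ord m2; lia.
rewrite big_split /= -big_distrr /= sum_nat_const leq_add //.
  by rewrite leq_mul2l /= -sum1_card [X in (_ <= X)%N]big_mkcond leq_sum // => t _; case: ifP.
by rewrite card_ffun !card_prod card_bool !card_ord mulnC (mul2n s) addnn.
Qed.

End FactorialShift.

(** * Solutions vanishing on every fibre *)

(** A function with [j] values factors through ['I_j], by an enumeration of its image. *)
Lemma card_small_image (T S : finType) (j : nat) : (0 < j)%N ->
  (#|[set f : {ffun T -> S} | #|[set f x | x : T]| == j]| <= #|S| ^ j * j ^ #|T|)%N.
Proof.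
move=> j_gt0.
pose comp (x : {ffun 'I_j -> S} * {ffun T -> 'I_j}) := [ffun t => x.1 (x.2 t)].
apply: (@leq_trans #|[set comp x | x in [set: {ffun 'I_j -> S} * {ffun T -> 'I_j}]]|).
  apply/subset_leq_card/subsetP => f; rewrite inE => /eqP card_f.
  have im_f t : f t \in [set f x | x : T] by apply: imset_f.
  pose r t := cast_ord card_f (enum_rank_in (im_f t) (f t)).
  apply/imsetP; exists ([ffun i => enum_val (cast_ord (esym card_f) i)], [ffun t => r t]).
    by rewrite inE.
  by apply/ffunP => t; rewrite !ffunE /= /r cast_ordK enum_rankK_in.
apply: leq_trans (leq_imset_card _ _) _.
by rewrite cardsT card_prod !card_ffun !card_ord.
Qed.

Lemma card_dep_pair (A B : finType) (f : A -> {set B}) :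
  #|[set x : A * B | x.2 \in f x.1]| = (\sum_a #|f a|)%N.
Proof.
rewrite -sum1_card; under eq_bigl do rewrite inE.
rewrite -(pair_big_dep xpredT (fun a b => b \in f a) (fun _ _ => 1%N)) /=.
by apply: eq_bigr => a _; rewrite sum1_card.
Qed.

Section Rosenthal.
Variables (F : finFieldType) (e : F -> algC).
Hypothesis e_char : nontrivial_character e.
Variables (J : finType) (w : J -> F).
Hypothesis w_neq0 : forall j, w j != 0.

Local Notation S := (expsum e w).

(** Even moments are energies; odd ones are needed because a fibre may have an odd number of
    indices. *)
Definition moment (n : nat) : algC := (\sum_a `|S a| ^+ n) / #|F|%:R.

Lemma moment_ge0 n : 0 <= moment n.
Proof. by apply: divr_ge0; rewrite ?ler0n //; apply: sumr_ge0 => a _; rewrite exprn_ge0. Qed.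

Lemma moment0 : moment 0 = 1.
Proof.
rewrite /moment; under eq_bigr do rewrite expr0.
by rewrite sumr_const divff // gt_eqF // (card_field_gt0 F).
Qed.

Lemma moment_energy n : moment (n + n) = (energy n w)%:R.
Proof. by rewrite /moment moment_eq_energy // mulrC mulKf // gt_eqF // (card_field_gt0 F). Qed.

(** Log-convexity, from Chebyshev's inequality with weights [|S a| ^+ 2]: all excess over 2 may be
    moved from one fibre to another. *)
Lemma moment_merge (a b : nat) :
  moment (a + 2) * moment (b + 2) <= moment 2 * moment (a + b + 2).
Proof.
rewrite /moment !mulrA ler_pM2r ?invr_gt0 ?(card_field_gt0 F) //.
rewrite ![_ / _ * _]mulrAC ler_pM2r ?invr_gt0 ?(card_field_gt0 F) //.
have sqM n : \sum_a `|S a| ^+ (n + 2) = \sum_a `|S a| ^+ 2 * `|S a| ^+ n.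
  by apply: eq_bigr => x _; rewrite -exprD addnC.
rewrite !sqM; apply: chebyshev_sum => x //; exact: exprn_ge0.
Qed.

Lemma prod_moment_le (d : seq nat) (x : nat) :
  \prod_(n <- x :: d) moment (n + 2) <=
  moment 2 ^+ size d * moment (\sum_(n <- x :: d) n + 2).
Proof.
elim: d x => [|y d IHd] x; first by rewrite !big_seq1 mul1r.
rewrite big_cons; apply: le_trans (ler_wpM2l (moment_ge0 _) (IHd y)) _.
rewrite mulrCA [in X in _ <= X]big_cons [size _]/= exprSr -mulrA.
by rewrite ler_wpM2l ?exprn_ge0 ?moment_ge0 // moment_merge.
Qed.

Lemma norm_expsum_sg k (t : bool * 'I_k) a : `|S (a * sg t)| = `|S a|.
Proof.
by rewrite /sg; case: t.1; rewrite ?mulr1 // mulrN1 expsumN // norm_conjC.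
Qed.

(** The equations for different [h] have disjoint variables, so detecting each by its own frequency
    [b h] makes the count a product. Absolute values remove the signs [sg i]. *)
Lemma card_fibre_le (s H : nat) (hh : {ffun bool * 'I_s -> 'I_H}) :
  #|[set f : {ffun bool * 'I_s -> J} |
      [forall h, \sum_(i | hh i == h) sg i * w (f i) == 0]]|%:R <=
  \prod_h moment #|[set i | hh i == h]|.
Proof.
rewrite -[X in X <= _]normr_nat cardsE -sum1_card natr_sum.
have -> : \sum_(f : {ffun bool * 'I_s -> J} |
      [forall h, \sum_(i | hh i == h) sg i * w (f i) == 0]) 1%:R =
    \sum_(b : {ffun 'I_H -> F}) \prod_(h : 'I_H) #|F|%:R^-1 *
       \prod_i S (b (hh i) * sg i) :> algC.
  under [RHS]eq_bigr => b _.
    rewrite /expsum bigA_distr_bigA /= big_distrr /=.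
    over.
  rewrite exchange_big /= big_mkcond /=; apply: eq_bigr => f _.
  have -> : (if [forall h, \sum_(i | hh i == h) sg i * w (f i) == 0] then 1%:R else 0) =
      \prod_h (\sum_a #|F|%:R^-1 * e (a * \sum_(i | hh i == h) sg i * w (f i))).
    under eq_bigr do rewrite -big_distrr /= sum_char // mulKf ?gt_eqF ?(card_field_gt0 F) //.
    case: forallP => [fib0|/forallP]; first by rewrite big1 // => h _; rewrite fib0.
    by rewrite negb_forall => /existsP[h /negPf hN]; rewrite (bigD1 h) //= hN mul0r.
  rewrite bigA_distr_bigA; apply: eq_bigr => b _; rewrite big_split /=; congr (_ * _).
  rewrite [RHS](partition_big hh xpredT) //=; apply: eq_bigr => h _.
  rewrite big_distrr /= (big_morph e (charD F e e_char) (char0 F e e_char)).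
  by apply: eq_bigr => i /eqP <-; rewrite mulrA.
apply: le_trans (ler_norm_sum _ _ _) _; rewrite /moment.
under [X in _ <= X]eq_bigr do rewrite mulrC big_distrr /=.
rewrite bigA_distr_bigA; apply: ler_sum => b _.
rewrite big_split /= normrM !normr_prod /=.
under eq_bigr do rewrite normfV normr_nat.
rewrite ler_wpM2l ?prodr_ge0 // => [_ _|]; first by rewrite invr_ge0 ler0n.
under eq_bigr do rewrite norm_expsum_sg.
rewrite (partition_big hh xpredT) //=; apply: ler_prod => h _.
rewrite prodr_ge0 //= (eq_bigr (fun=> `|S (b h)|)) => [|i /eqP-> //].
by rewrite prodr_const cardsE.
Qed.

(** Here [j] is the number of distinct shifts in the tuple. Nonempty fibres have at least two
    indices, so [j <= s], and merging them leaves [j.-1] second moments and one large moment. *)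
Lemma card_vanishing_fibres_le (s H : nat) : (0 < s)%N ->
  (#|vanishing_fibres s H w| <=
   \sum_(1 <= j < s.+1)
     H ^ j * j ^ (s + s) * (energy 1 w ^ j.-1 * energy (s - j.-1) w))%N.
Proof.
move=> s_gt0.
pose T := (bool * 'I_s)%type.
have cardT : #|{: T}| = (s + s)%N by rewrite card_prod card_bool card_ord mul2n addnn.
pose fib (hh : {ffun T -> 'I_H}) :=
  [set f : {ffun T -> J} | [forall h, \sum_(i | hh i == h) sg i * w (f i) == 0]].
pose im (hh : {ffun T -> 'I_H}) := [set hh i | i : T].
have le_fib : (#|vanishing_fibres s H w| <= \sum_hh #|fib hh|)%N.
  pose phi (t : {ffun T -> 'I_H * J}) := ([ffun i => (t i).1], [ffun i => (t i).2]).
  have phi_inj : injective phi.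
    move=> t1 t2 [/ffunP E1 /ffunP E2]; apply/ffunP => i.
    by move: (E1 i) (E2 i); rewrite !ffunE; case: (t1 i) (t2 i) => [? ?] [? ?] /= -> ->.
  rewrite -(card_imset _ phi_inj).
  rewrite -(card_dep_pair _ _ fib).
  apply/subset_leq_card/subsetP => x /imsetP[t]; rewrite /vanishing_fibres inE => /forallP t_van ->.
  rewrite !inE /=; apply/forallP => h; move: (t_van h).
  under eq_bigl do rewrite ffunE.
  by under eq_bigr do rewrite ffunE.
apply: leq_trans le_fib _.
pose G j := (energy 1 w ^ j.-1 * energy (s - j.-1) w)%N.
have fib_le hh : (#|fib hh| <= \sum_(1 <= j < s.+1) (#|im hh| == j) * G j)%N.
  (* A singleton fibre would force [w (f i0) = 0], so such an [hh] admits no [f]. *)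
  have [h /cards1P[i0 Ei0]|no1] := pickP (fun h => #|[set i | hh i == h]| == 1%N).
    rewrite (_ : #|fib hh| = 0%N) //; apply/eqP; rewrite cards_eq0 -subset0.
    apply/subsetP => f; rewrite !inE => /forallP/(_ h).
    rewrite (big_pred1 i0) => [|i]; last by move/setP/(_ i): Ei0; rewrite !inE.
    by rewrite mulf_eq0 (negPf (w_neq0 _)) orbF /sg; case: ifP => _;
      rewrite ?oppr_eq0 oner_eq0.
  pose n h := #|[set i | hh i == h]|.
  have im_n h : (h \in im hh) = (0 < n h)%N.
    rewrite card_gt0; apply/imsetP/set0Pn => [[i _ ->]|[i]]; first by exists i; rewrite inE.
    by rewrite inE => /eqP <-; exists i.
  have n_ge2 h : h \in im hh -> (2 <= n h)%N.
    by rewrite im_n => n_gt0; rewrite ltn_neqAle n_gt0 eq_sym no1.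
  have sum_n : (\sum_(h in im hh) n h = s + s)%N.
    rewrite -cardT -[RHS]sum1_card (partition_big hh (mem (im hh))) /=; last first.
      by move=> i _; apply: imset_f.
    by apply: eq_bigr => h _; rewrite /n -sum1_card; apply: eq_bigl => i; rewrite inE.
  have sum_n2 : (\sum_(h in im hh) (n h - 2) + 2 * #|im hh| = s + s)%N.
    rewrite -sum_n mulnC -sum_nat_const -big_split /=.
    by apply: eq_bigr => h /n_ge2; lia.
  have im_gt0 : (0 < #|im hh|)%N.
    by rewrite card_gt0; apply/set0Pn; exists (hh (true, Ordinal s_gt0)); apply: imset_f.
  have im_le : (#|im hh| <= s)%N.
    by rewrite -leq_double -!addnn -[X in (_ <= X)%N]sum_n2 mul2n -addnn leq_addl.
  rewrite (bigD1_seq #|im hh|) ?iota_uniq //=; last first.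
    by rewrite mem_index_iota im_gt0 ltnS.
  rewrite eqxx mul1n; apply: leq_trans (leq_addr _ _).
  rewrite -(ler_nat algC) /G natrM natrX -!moment_energy.
  apply: le_trans (card_fibre_le _ _ _) _.
  have -> : \prod_h moment #|[set i | hh i == h]| = \prod_(h in im hh) moment (n h - 2 + 2).
    rewrite [RHS]big_mkcond; apply: eq_bigr => h _; case: ifPn => [/n_ge2|].
      by move=> n2; rewrite subnK.
    by rewrite im_n -eqn0Ngt /n => /eqP->; rewrite moment0.
  rewrite -big_enum -(big_map (fun h => n h - 2)%N xpredT (fun d => moment (d + 2))) /=.
  move: sum_n2; rewrite -big_enum -(big_map (fun h => n h - 2)%N xpredT id) /= cardE.
  rewrite -(size_map (fun h => n h - 2)%N); move: im_gt0.
  rewrite cardE -(size_map (fun h => n h - 2)%N).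
  case: [seq _ | _ <- _] => // x d _ sum_d.
  apply: le_trans (prod_moment_le _ _) _ => /=.
  (* Here [size d] is [j - 1], so the merged exponent is [2s - 2(j - 1)]: even, hence an energy. *)
  rewrite (_ : \sum_(i <- x :: d) i + 2 = s - size d + (s - size d))%N //.
  by move: sum_d => /=; lia.
apply: (@leq_trans (\sum_hh \sum_(1 <= j < s.+1) (#|im hh| == j) * G j)%N).
  by apply: leq_sum => hh _; exact: fib_le.
rewrite exchange_big /= !big_seq; apply: leq_sum => j; rewrite mem_index_iota => /andP[j_gt0 _].
rewrite -big_distrl /= leq_mul2r; apply/orP; right.
rewrite -cardT -[H in (H ^ j)%N]card_ord; apply: leq_trans (card_small_image _ _ _ j_gt0).
by rewrite -sum1_card [X in (_ <= X)%N]big_mkcond leq_sum // => hh _; rewrite inE; case: eqP.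
Qed.

End Rosenthal.

(** * The circle method *)

Definition representations {F : finFieldType} {I : finType} (r : nat) (u : I -> F) (x : F) :
  nat := #|[set f : {ffun 'I_r -> I} | \sum_i u (f i) == x]|.

Section CircleMethod.
Variables (F : finFieldType) (e : F -> algC).
Hypothesis e_char : nontrivial_character e.

Lemma expsum_exp (I : finType) (u : I -> F) r a :
  expsum e u a ^+ r = \sum_x (representations r u x)%:R * e (a * x).
Proof.
rewrite -[r in LHS]card_ord -prodr_const /expsum bigA_distr_bigA /=.
rewrite (partition_big (fun f : {ffun 'I_r -> I} => \sum_i u (f i)) xpredT) //=.
apply: eq_bigr => x _; rewrite /representations cardsE -sum1_card natr_sum big_distrl /=.
by apply: eq_bigr => f /eqP <-; rewrite mul1r big_distrr /= char_sum.
Qed.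

Lemma sum_representations (I : finType) (u : I -> F) r :
  \sum_x (representations r u x)%:R = #|I|%:R ^+ r :> algC.
Proof.
transitivity (\sum_x (representations r u x)%:R * e (0 * x)).
  by apply: eq_bigr => x _; rewrite mul0r char0 // mulr1.
rewrite -expsum_exp /expsum; under eq_bigr do rewrite mul0r char0 //.
by rewrite sumr_const.
Qed.

(** Parseval: multiplied by [#|F|], both sides equal the moment of order [2r]. *)
Lemma sum_sqr_representations (I : finType) (u : I -> F) r :
  \sum_x (representations r u x)%:R ^+ 2 = (energy r u)%:R :> algC.
Proof.
apply: (mulfI (lt0r_neq0 (card_field_gt0 F))); rewrite -(moment_eq_energy F e e_char).
pose N x : algC := (representations r u x)%:R.
transitivity (\sum_a \sum_x \sum_y N x * N y * e (a * (x - y))).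
  rewrite exchange_big big_distrr /=; apply: eq_bigr => x _.
  rewrite exchange_big (bigD1 x) //= [X in _ = _ + X]big1 => [|y xy].
    by rewrite addr0 -big_distrr /= subrr sum_char // eqxx mulr1 mulrC -expr2.
  by rewrite -big_distrr /= sum_char // subr_eq0 eq_sym (negPf xy) !mulr0.
apply: eq_bigr => a _; rewrite addnn -mul2n mulnC exprM -normrX normCK expsum_exp.
rewrite rmorph_sum big_distrlr /=; apply: eq_bigr => x _; apply: eq_bigr => y _.
have -> : ((representations r u y)%:R * e (a * y))^* = N y * (e (a * y))^*.
  by rewrite rmorphM /= conjC_nat.
rewrite mulrACA; congr (_ * _).
by rewrite mulrBr charD // charN.
Qed.

(** Division by 0 gives 0, so this phase also works at [z = 0]. *)
Lemma norm_divK (z : algC) : `|z| / z * z = `|z|.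
Proof. by have [->|z0] := eqVneq z 0; rewrite ?mulr0 ?normr0 ?divfK. Qed.

Lemma norm_div_le1 (z : algC) : `| `|z| / z | <= 1.
Proof.
have [->|z0] := eqVneq z 0; first by rewrite normr0 mul0r normr0 ler01.
by rewrite normrM normr_id normfV divff // normr_eq0.
Qed.

(** Hoelder in [i] raises the inner sums to the power [l.+1]. The phases [th] remove absolute
    values, and grouping the [l.+1] variables by their sum [x] gives the sum of [N x * G x]. Hoelder
    and Cauchy-Schwarz in [x] then separate the energy of [w] from a weighted moment of [g]. *)
Lemma bilinear_expsum_le (I J : finType) (g : I -> F) (w : J -> F) (k l : nat) (a : F) :
  a != 0 ->
  `|expsum e (fun x : I * J => g x.1 * w x.2) a| ^+ (l.+1 * (k.+1 + k.+1)) <=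
  (#|I| ^ l) %:R ^+ (k.+1 + k.+1) * (#|J|%:R ^+ l.+1) ^+ (k + k) *
  (energy l.+1 w)%:R * (#|F|%:R * (energy k.+1 g)%:R).
Proof.
move=> a_neq0.
pose B i := expsum e w (a * g i) ^+ l.+1.
pose th i := `|B i| / B i.
pose N x : algC := (representations l.+1 w x)%:R.
pose G x := `|\sum_i th i * e (x * (a * g i))|.
have N_ge0 x : 0 <= N x by rewrite ler0n.
have G_ge0 x : 0 <= G x by rewrite normr_ge0.
have step1 : `|expsum e (fun x : I * J => g x.1 * w x.2) a| ^+ l.+1 <=
    (#|I| ^ l)%:R * \sum_x N x * G x.
  have -> : expsum e (fun x : I * J => g x.1 * w x.2) a = \sum_i expsum e w (a * g i).
    rewrite /expsum -(pair_bigA _ (fun i j => e (a * (g i * w j)))) /=.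
    by apply: eq_bigr => i _; apply: eq_bigr => j _; rewrite mulrA.
  apply: (@le_trans _ _ ((\sum_i `|expsum e w (a * g i)|) ^+ l.+1)).
    by rewrite lerXn2r ?nnegrE ?sumr_ge0 ?ler_norm_sum.
  apply: le_trans (power_mean _ _ _ _ _) _ => //.
  rewrite natrX ler_wpM2l ?exprn_ge0 ?ler0n //.
  rewrite -[X in X <= _]ger0_norm; last by apply: sumr_ge0 => i _; rewrite exprn_ge0.
  have -> : \sum_i `|expsum e w (a * g i)| ^+ l.+1 =
      \sum_x N x * \sum_i th i * e (x * (a * g i)).
    under [RHS]eq_bigr do rewrite big_distrr /=.
    rewrite exchange_big /=; apply: eq_bigr => i _.
    rewrite -normrX -/(B i) -norm_divK -/(th i) /B expsum_exp big_distrr /=.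
    by apply: eq_bigr => x _; rewrite mulrCA (mulrC x).
  apply: le_trans (ler_norm_sum _ _ _) _; apply: ler_sum => x _.
  by rewrite normrM ger0_norm.
have step2 : (\sum_x N x * G x) ^+ (k.+1 + k.+1) <=
    (#|J|%:R ^+ l.+1) ^+ (k + k) * (energy l.+1 w)%:R * \sum_x G x ^+ (k.+1 + k.+1).
  rewrite -(sum_representations J w) -(sum_sqr_representations J w) -/N.
  apply: (@le_trans _ _ (((\sum_x N x) ^+ k * \sum_x N x * G x ^+ k.+1) ^+ 2)).
    rewrite addnn -muln2 exprM lerXn2r ?nnegrE ?exprn_ge0 ?mulr_ge0 ?exprn_ge0 ?sumr_ge0 //.
      by move=> x _; rewrite mulr_ge0.
    by move=> x _; rewrite mulr_ge0 ?exprn_ge0.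
    exact: weighted_power_mean.
  rewrite exprMn -exprM muln2 -addnn -mulrA ler_wpM2l ?exprn_ge0 ?sumr_ge0 //.
  under [X in _ <= _ * X]eq_bigr do rewrite addnn -muln2 exprM.
  by apply: cauchy_schwarz_sum => x; rewrite ?exprn_ge0.
have step3 : \sum_x G x ^+ (k.+1 + k.+1) <= #|F|%:R * (energy k.+1 g)%:R.
  apply: le_trans (weighted_moment_le_energy F e e_char k.+1 I g th _); last first.
    by move=> i; apply: norm_div_le1.
  (* As [a] is nonzero, [x * a] runs through the whole field. *)
  rewrite [X in _ <= X](reindex_inj (mulIf a_neq0)) /=; apply: ler_sum => x _.
  rewrite (_ : G x = `|\sum_i th i * e (x * a * g i)|) //.
  by congr (`|_|); apply: eq_bigr => i _; rewrite (mulrA x).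
rewrite exprM; apply: (@le_trans _ _ (((#|I| ^ l)%:R * \sum_x N x * G x) ^+ (k.+1 + k.+1))).
  rewrite lerXn2r ?nnegrE ?exprn_ge0 ?mulr_ge0 ?ler0n ?sumr_ge0 // => x _.
  by rewrite mulr_ge0.
rewrite exprMn -!mulrA ler_wpM2l ?exprn_ge0 ?ler0n //; apply: le_trans step2 _.
by rewrite -!mulrA !ler_wpM2l ?exprn_ge0 ?ler0n.
Qed.

(** Frequency 0 gives the main term. At the others, [t] factors are bounded by the maximum and the
    remaining [2s] are summed by the energy. Working with [D]-th powers lets the bilinear bound
    enter as it stands. *)
Lemma circle_method (I : finType) (u : I -> F) (s t D : nat) (x : F) (B : algC) :
  (0 < D)%N -> 0 <= B -> (forall a, a != 0 -> `|expsum e u a| ^+ D <= B) ->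
  `|#|F|%:R * (representations (t + (s + s)) u x)%:R - #|I|%:R ^+ (t + (s + s))| ^+ D <=
  B ^+ t * (#|F|%:R * (energy s u)%:R) ^+ D.
Proof.
move=> D_gt0 B_ge0 le_B; set r := (t + (s + s))%N.
pose b := D.-root B.
have b_ge0 : 0 <= b by rewrite rootC_ge0.
have -> : #|F|%:R * (representations r u x)%:R - #|I|%:R ^+ r =
    \sum_(a | a != 0) expsum e u a ^+ r * e (a * - x).
  have -> : #|F|%:R * (representations r u x)%:R =
      \sum_a expsum e u a ^+ r * e (a * - x).
    under [RHS]eq_bigr => a _.
      rewrite expsum_exp big_distrl /=.
      under eq_bigr do rewrite -mulrA -(charD F e e_char) -mulrDr.
      over.
    rewrite exchange_big (bigD1 x) //= [X in _ = _ + X]big1 => [|y xy].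
      by rewrite addr0 -big_distrr /= sum_char // subrr eqxx mulr1 mulrC.
    by rewrite -big_distrr /= sum_char // subr_eq0 (negPf xy) !mulr0.
  have S0 : expsum e u 0 = #|I|%:R.
    rewrite /expsum; under eq_bigr do rewrite mul0r (char0 F e e_char).
    by rewrite sumr_const.
  by rewrite (bigD1 0) //= mul0r (char0 F e e_char) mulr1 S0 addrAC subrr add0r.
rewrite -[B](rootCK D_gt0) -/b -exprM mulnC exprM -exprMn.
rewrite lerXn2r ?nnegrE ?mulr_ge0 ?exprn_ge0 ?ler0n //.
rewrite -(moment_eq_energy F e e_char) big_distrr /=.
apply: le_trans (ler_norm_sum _ _ _) _.
(* The moment also contains [a = 0], whose nonnegative term is dropped. *)
rewrite [X in _ <= X](bigID (fun a => a != 0)) /=.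
rewrite -[X in X <= _]addr0 lerD //; last first.
  by apply: sumr_ge0 => a _; rewrite mulr_ge0 ?exprn_ge0.
apply: ler_sum => a a_neq0; rewrite normrM (norm_char F e e_char) mulr1 normrX /r exprD.
rewrite ler_wpM2r ?exprn_ge0 // lerXn2r ?nnegrE //.
by rewrite -[X in X <= _](exprCK D_gt0) ?normr_ge0 // ler_rootC ?nnegrE ?exprn_ge0 // le_B.
Qed.

End CircleMethod.

(** * Energy bounds *)

Lemma factorial_product_energy_le (p K M H s : nat) (J : finType) (w : J -> 'F_p) :
  prime p -> (0 < s)%N -> (0 < H)%N -> (K + M < p)%N -> (forall j, w j != 0) ->
  (H ^ (s + s) * energy s (fun x : 'I_M.+1 * J => (K + x.1)`!%:R * w x.2)%R <=
   M.+1 ^ (s + s).-1 *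
   (M.+1 * \sum_(1 <= j < s.+1)
      H ^ j * j ^ (s + s) * (energy 1 w ^ j.-1 * energy (s - j.-1) w) +
    2 * H.-1 * (H * #|J|) ^ (s + s)))%N.
Proof.
move=> pr_p s_gt0 H_gt0 lt_p w_neq0.
have [e e_char] := exists_nontrivial_character p pr_p.
apply: leq_trans (shift_energy_le _ e e_char s M H J (fun m => (K + m)`!%:R) w s_gt0) _.
rewrite leq_mul2l; apply/orP; right.
apply: leq_trans (energy_sum_le p pr_p K M H s J w H_gt0 lt_p) _.
rewrite leq_add2r leq_mul2l /=.
exact: card_vanishing_fibres_le e_char _ _ w_neq0 _ _ s_gt0.
Qed.

(** The product bound for the one-point sequence [w = 1], whose energies are at most 1. *)
Lemma factorial_energy_le (p K M H s : nat) :
  prime p -> (0 < s)%N -> (0 < H)%N -> (K + M < p)%N ->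
  (H ^ (s + s) * energy s (fun m : 'I_M.+1 => (K + m)`!%:R : 'F_p)%R <=
   M.+1 ^ (s + s).-1 *
   (M.+1 * (s * s ^ (s + s) * H ^ s) + 2 * H.-1 * H ^ (s + s)))%N.
Proof.
move=> pr_p s_gt0 H_gt0 lt_p.
have [e e_char] := exists_nontrivial_character p pr_p.
pose w (_ : unit) : 'F_p := 1.
have w_neq0 j : w j != 0 by rewrite oner_eq0.
have -> : energy s (fun m : 'I_M.+1 => (K + m)`!%:R : 'F_p) =
    energy s (fun x : 'I_M.+1 * unit => (K + x.1)`!%:R * w x.2).
  apply/eqP; rewrite -(eqr_nat algC) -(inj_eq (mulfI (lt0r_neq0 (card_field_gt0 'F_p)))).
  rewrite -!(moment_eq_energy _ e e_char); apply/eqP/eq_bigr => a _.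
  congr (`|_| ^+ _); rewrite /expsum.
  rewrite -(pair_bigA _ (fun (m : 'I_M.+1) (j : unit) => e (a * ((K + m)`!%:R * w j)))) /=.
  by apply: eq_bigr => m _; rewrite (bigD1 tt) //= big1 ?addr0 ?mulr1 // => -[].
apply: leq_trans (factorial_product_energy_le _ _ _ _ _ _ _ pr_p s_gt0 H_gt0 lt_p w_neq0) _.
have E1 i : (energy i w <= 1)%N.
  by apply: leq_trans (max_card _) _; rewrite card_ffun card_unit exp1n.
rewrite card_unit muln1 leq_mul2l leq_add2r leq_mul2l; apply/orP; right; apply/orP; right.
apply: (@leq_trans (\sum_(1 <= j < s.+1) H ^ s * s ^ (s + s))%N); last first.
  by rewrite sum_nat_const_nat subSS subn0 -mulnA (mulnC (s ^ _)%N).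
rewrite !big_seq; apply: leq_sum => j; rewrite mem_index_iota ltnS => /andP[j_gt0 le_j].
rewrite -[X in (_ <= X)%N]muln1; apply: leq_mul.
  by apply: leq_mul; rewrite ?leq_pexp2l // leq_exp2r // addn_gt0 s_gt0.
rewrite -[X in (_ <= X)%N]muln1; apply: leq_mul => //.
by rewrite -[X in (_ <= X)%N](exp1n j.-1); case: j.-1 => // n; rewrite leq_exp2r.
Qed.

(** * Optimal block lengths *)

Section RealBounds.
Variable R : realType.
Implicit Types (C W rho : R).

(** For [rho < 1] the block has length 1, and the error term with factor [H.-1] disappears. *)
Definition block (rho : R) : nat := maxn 1 (Num.truncn rho).

Lemma block_gt0 rho : (0 < block rho)%N. Proof. by rewrite /block leq_maxl. Qed.

Lemma le_double_block rho : 0 <= rho -> rho <= 2 * (block rho)%:R.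
Proof.
move=> rho0; have /andP[_ lt] := truncn_itv rho0.
apply: le_trans (ltW lt) _; rewrite -natrM ler_nat /block; lia.
Qed.

Lemma block_pred_le rho : 0 <= rho -> (block rho).-1%:R <= rho.
Proof.
move=> rho0; rewrite /block; have /andP[le _] := truncn_itv rho0.
by apply: le_trans le; rewrite ler_nat; lia.
Qed.

Lemma block_le rho B : 1 <= B -> 0 <= rho <= B -> (block rho)%:R <= B.
Proof.
move=> B1 /andP[rho0 le_B]; rewrite /block; have /andP[le _] := truncn_itv rho0.
by rewrite /maxn; case: ifP => _; rewrite // (le_trans le).
Qed.

(* The last hypothesis says that H = rho balances the two terms of the bound. *)
Lemma balance_block (s i M N E Z : nat) C W rho :
  (0 < M)%N -> (i <= s + s)%N -> 0 < rho -> 0 <= C ->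
  (block rho ^ (s + s) * E <= M ^ (s + s).-1 *
     (M * Z + 2 * (block rho).-1 * (block rho * N) ^ (s + s)))%N ->
  Z%:R <= C * (block rho)%:R ^+ i * W ->
  M%:R * W = rho ^+ (s + s - i) * rho * N%:R ^+ (s + s) ->
  E%:R <= (C * 2 ^+ (s + s) + 2) * (M%:R ^+ (s + s).-1 * N%:R ^+ (s + s) * rho).
Proof.
move=> M_gt0 le_i rho_gt0 C_ge0 le_E le_Z eq_W.
set H := block rho in le_E le_Z *.
have H_gt0 : 0 < H%:R :> R by rewrite ltr0n block_gt0.
have rho_le : rho <= 2 * H%:R by rewrite le_double_block ?ltW.
have H_le : H.-1%:R <= rho by rewrite block_pred_le ?ltW.
rewrite -(ler_pM2l (exprn_gt0 (s + s) H_gt0)).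
move: le_E; rewrite -(ler_nat R) !(natrM, natrD, natrX) => /le_trans; apply.
rewrite [leRHS](_ : _ = M%:R ^+ (s + s).-1 * ((C * 2 ^+ (s + s) + 2) *
  (H%:R ^+ (s + s) * N%:R ^+ (s + s) * rho))); last by ring.
rewrite ler_wpM2l ?exprn_ge0 ?ler0n //.
rewrite [leRHS]mulrDl lerD //.
  apply: le_trans (ler_wpM2l (ler0n _ M) le_Z) _.
  rewrite (_ : M%:R * (C * H%:R ^+ i * W) = C * H%:R ^+ i * (M%:R * W)); last by ring.
  rewrite eq_W.
  rewrite (_ : C * 2 ^+ (s + s) * (H%:R ^+ (s + s) * N%:R ^+ (s + s) * rho) =
    C * H%:R ^+ i * ((2 ^+ i * (2 * H%:R) ^+ (s + s - i)) * rho * N%:R ^+ (s + s))); last first.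
    by rewrite exprMn -{1 2}(subnKC le_i) !exprD; ring.
  rewrite ler_wpM2l ?mulr_ge0 ?exprn_ge0 ?ler0n // ler_wpM2r ?exprn_ge0 ?ler0n //.
  rewrite (ler_wpM2r (ltW rho_gt0)) // -[X in X <= _]mul1r ler_pM ?exprn_ge0 ?ler01 //;
    try exact: ltW.
    by rewrite exprn_ege1 // ler1n.
  by rewrite lerXn2r ?nnegrE ?mulr_ge0 ?ler0n ?(ltW rho_gt0).
rewrite -mulrA ler_wpM2l ?ler0n // exprMn mulrC ler_wpM2l //.
by rewrite mulr_ge0 ?exprn_ge0 ?ler0n.
Qed.

Definition energy_const (s : nat) : nat := (s * s ^ (s + s) * 2 ^ (s + s) + 2)%N.

Lemma energy_const_mono s t : (0 < s)%N -> (s <= t)%N -> (energy_const s <= energy_const t)%N.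
Proof.
move=> s_gt0 le_st; rewrite /energy_const leq_add2r leq_mul ?leq_exp2l ?leq_add //.
rewrite leq_mul //; apply: (@leq_trans (t ^ (s + s))%N).
  by rewrite leq_exp2r ?addn_gt0 ?s_gt0.
by rewrite leq_pexp2l ?leq_add // (leq_trans s_gt0).
Qed.

(** This [rho] solves [rho ^+ s * rho = M.+1%:R], the balance condition with [N = 1], [W = 1] and
    [i = s]. *)
Lemma factorial_energy_bound (p K M s : nat) :
  prime p -> (0 < s)%N -> (K + M < p)%N ->
  (energy s (fun m : 'I_M.+1 => (K + m)`!%:R : 'F_p)%R)%:R <=
  (energy_const s)%:R * (M.+1%:R ^+ (s + s).-1 * M.+1%:R `^ (s.+1%:R)^-1) :> R.
Proof.
move=> pr_p s_gt0 lt_p.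
set rho := _ `^ _.
have rho_gt0 : 0 < rho by rewrite powR_gt0 ?ltr0n.
have := factorial_energy_le _ _ _ _ _ pr_p s_gt0 (block_gt0 rho) lt_p.
set E := energy s _ => le_E.
have -> : (energy_const s)%:R = (s * s ^ (s + s))%:R * 2 ^+ (s + s) + 2 :> R.
  by rewrite /energy_const natrD natrM natrX.
have := @balance_block s s M.+1 1 E (s * s ^ (s + s) * block rho ^ s)
  (s * s ^ (s + s))%:R 1 rho.
rewrite expr1n !mulr1; apply=> //.
- exact: leq_addr.
- by rewrite muln1.
- by rewrite natrM natrX.
rewrite addnK -exprSr /rho -powR_mulrn ?powR_ge0 // -powRrM.
by rewrite mulVf ?pnatr_eq0 // powRr1.
Qed.

End RealBounds.

Definition shifted_fact (p L N : nat) (n : 'I_N.+1) : 'F_p := (L + n)`!%:R.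

Section FactorialBounds.
Variable R : realType.

Lemma natr_doubleB1 (s : nat) : (0 < s)%N -> ((s + s).-1%:R : R) = 2 * s%:R - 1.
Proof.
by move=> s_gt0; rewrite -subn1 natrB ?addn_gt0 ?s_gt0 // natrD; ring.
Qed.

Lemma exprn_powR (x : R) (n : nat) : 0 <= x -> x ^+ n = x `^ n%:R.
Proof. by move=> x0; rewrite powR_mulrn. Qed.

Lemma powR_mul_same (x a b : R) : 0 < x -> x `^ a * x `^ b = x `^ (a + b).
Proof. by move=> x0; rewrite powRD // (gt_eqF x0) implybT. Qed.

(** Compares term [j = d + 1] of the fibre count with term [j = 1], where [s = i + d] and the first
    energy is bounded by [x^(3/2)]. The exponents reduce to [1/(i+1) - 1/(s+1) <= d/(2(s+1))]; the
    left side is [d/((i+1)(s+1))] and [i >= 1]. *)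
Lemma intermediate_moment_le (x h : R) (i d : nat) : 1 <= x -> (0 < i)%N -> 0 <= h ->
  ((0 < d)%N -> h <= x `^ (1 / 2 - 1 / (2 * (i + d).+1%:R))) ->
  h ^+ d * ((x * x `^ 2^-1) ^+ d * (x ^+ (i + i).-1 * x `^ (i.+1%:R)^-1)) <=
  x ^+ ((i + d) + (i + d)).-1 * x `^ ((i + d).+1%:R)^-1.
Proof.
move=> x1 i_gt0 h0 le_h; have x_gt0 : 0 < x by apply: lt_le_trans x1.
have x0 := ltW x_gt0.
have [->|d_gt0] := posnP d; first by rewrite !expr0 !mul1r addn0.
apply: (@le_trans _ _ ((x `^ (1 / 2 - 1 / (2 * (i + d).+1%:R))) ^+ d *
  ((x * x `^ 2^-1) ^+ d * (x ^+ (i + i).-1 * x `^ (i.+1%:R)^-1)))).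
  rewrite ler_wpM2r ?mulr_ge0 ?exprn_ge0 ?mulr_ge0 ?powR_ge0 //.
  by rewrite lerXn2r ?nnegrE ?powR_ge0 ?le_h.
rewrite -[x in x * x `^ 2^-1](powRr1 x0) !exprn_powR ?mulr_ge0 ?powR_ge0 //.
rewrite -?powRrM !powR_mul_same // -!powRrM !powR_mul_same //; apply: ler_powR => //.
rewrite !natr_doubleB1 ?addn_gt0 ?i_gt0 // -[i.+1%:R]natr1 -[(i + d).+1%:R]natr1 !natrD.
have i1 : 1 <= i%:R :> R by rewrite ler1n.
have d1 : 1 <= d%:R :> R by rewrite ler1n.
move: (i%:R : R) (d%:R : R) i1 d1 => I D I1 D1.
pose a := (I + D + 1)^-1; pose b := (I + 1)^-1.
have a_gt0 : 0 < a by rewrite invr_gt0; lra.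
have b_le : b <= 1 / 2 by rewrite /b div1r lef_pV2 ?posrE; lra.
have ab : b - a = D * a * b.
  by rewrite /a /b; field; apply/andP; split; rewrite gt_eqF //; lra.
have -> : 1 / (2 * (I + D + 1)) = a / 2.
  by rewrite /a; field; rewrite gt_eqF //; lra.
rewrite -/a -/b.
have : D * a * b <= D * a * (1 / 2) by rewrite ler_wpM2l // mulr_ge0 //; lra.
lra.
Qed.

(** The factors account for the number of terms, for [j ^ (s + s)], and for at most [s] energies per
    term. *)
Definition fibre_const (s : nat) : nat := (s * s ^ (s + s) * energy_const s ^ s)%N.

(** For such [H] the term [j = 1] dominates; when [s = 1] it is the only term, so [H] is
    unrestricted. *)
Lemma sum_moments_le (p L N H s : nat) :
  prime p -> (0 < s)%N -> (0 < H)%N -> (L + N < p)%N ->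
  ((1 < s)%N -> H%:R <= N.+1%:R `^ (1 / 2 - 1 / (2 * s.+1%:R)) :> R) ->
  (\sum_(1 <= j < s.+1)
      H ^ j * j ^ (s + s) *
      (energy 1 (shifted_fact p L N) ^ j.-1 *
       energy (s - j.-1) (shifted_fact p L N)))%:R <=
  (fibre_const s)%:R * H%:R ^+ 1 * (N.+1%:R ^+ (s + s).-1 * N.+1%:R `^ (s.+1%:R)^-1) :> R.
Proof.
move=> pr_p s_gt0 H_gt0 lt_p le_H; set w := shifted_fact p L N.
set W := N.+1%:R ^+ _ * _.
have W_ge0 : 0 <= W by rewrite mulr_ge0 ?exprn_ge0 ?powR_ge0.
have const_gt0 : (0 < energy_const s)%N by rewrite /energy_const addn_gt0 orbT.
rewrite natr_sum; apply: (@le_trans _ _ (\sum_(1 <= j < s.+1)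
  (s ^ (s + s) * energy_const s ^ s)%:R * H%:R * W)); last first.
  rewrite sumr_const_nat subSS subn0 /fibre_const expr1 !natrM.
  by rewrite ?mulr1 -[leLHS]mulr_natl !mulrA ?mulr1.
rewrite !big_seq; apply: ler_sum => j; rewrite mem_index_iota ltnS => /andP[j_gt0 le_j].
case: j j_gt0 le_j => // d _ lt_d /=.
pose i := (s - d)%N; have i_gt0 : (0 < i)%N by rewrite subn_gt0.
have def_s : s = (i + d)%N by rewrite subnK // ltnW.
have E_le t : (0 < t <= s)%N -> (energy t w)%:R <=
    (energy_const s)%:R * (N.+1%:R ^+ (t + t).-1 * N.+1%:R `^ (t.+1%:R)^-1) :> R.
  case/andP=> t_gt0 le_t; apply: le_trans (factorial_energy_bound R p L N t pr_p t_gt0 lt_p) _.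
  rewrite ler_wpM2r ?mulr_ge0 ?exprn_ge0 ?powR_ge0 // ler_nat.
  exact: energy_const_mono.
have := @intermediate_moment_le N.+1%:R H%:R i d; rewrite -def_s -/W => /(_ _ i_gt0).
rewrite ler1n ler0n => /(_ isT isT) le_W.
have {}le_W : H%:R ^+ d * ((N.+1%:R * N.+1%:R `^ 2^-1) ^+ d *
    (N.+1%:R ^+ (i + i).-1 * N.+1%:R `^ (i.+1%:R)^-1)) <= W.
  by apply: le_W => d_gt0; apply: le_H; apply: leq_trans lt_d.
set C : R := (energy_const s)%:R in E_le *.
have C_ge1 : 1 <= C by rewrite /C ler1n.
have C_ge0 : 0 <= C by apply: le_trans C_ge1.
have E1_le : (energy 1 w)%:R <= C * (N.+1%:R * N.+1%:R `^ 2^-1) :> R by apply: (E_le 1%N).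
have Ei_le := E_le i; rewrite i_gt0 leq_subr in Ei_le; move/(_ isT) in Ei_le.
have core : H%:R ^+ d * ((energy 1 w)%:R ^+ d * (energy i w)%:R) <= C ^+ s * W.
  apply: (@le_trans _ _ (H%:R ^+ d * ((C * (N.+1%:R * N.+1%:R `^ 2^-1)) ^+ d *
      (C * (N.+1%:R ^+ (i + i).-1 * N.+1%:R `^ (i.+1%:R)^-1))))).
    rewrite ler_wpM2l ?exprn_ge0 ?ler0n // ler_pM ?exprn_ge0 ?ler0n //.
    by rewrite lerXn2r ?nnegrE ?ler0n ?mulr_ge0 ?powR_ge0.
  apply: (@le_trans _ _ (C ^+ d.+1 * W)).
    rewrite [leLHS](_ : _ = C ^+ d.+1 * (H%:R ^+ d * ((N.+1%:R * N.+1%:R `^ 2^-1) ^+ d *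
      (N.+1%:R ^+ (i + i).-1 * N.+1%:R `^ (i.+1%:R)^-1)))).
      by rewrite ler_wpM2l ?exprn_ge0.
    by rewrite exprMn exprS; ring.
  by rewrite ler_wpM2r // ler_weXn2l.
rewrite !natrM !natrX [leLHS](_ : _ = d.+1%:R ^+ (s + s) * (H%:R *
  (H%:R ^+ d * ((energy 1 w)%:R ^+ d * (energy i w)%:R)))); last by rewrite exprS; ring.
rewrite -[leRHS]mulrA -[leRHS]mulrA ler_pM ?exprn_ge0 ?mulr_ge0 ?exprn_ge0 ?ler0n //.
  by rewrite lerXn2r ?nnegrE ?ler0n ?ler_nat.
by rewrite [leRHS]mulrCA ler_wpM2l ?ler0n.
Qed.

(** With [W = N^(2s-1+1/(s+1))], the bound for the energy of [n!], this [rho] solves the balance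
    condition [M W = (rho N)^(2s)]; here [M], [N] stand for the lengths [M.+1], [N.+1]. *)
Lemma factorial_product_energy_bound (p K M L N s : nat) :
  prime p -> (0 < s)%N -> (K + M < p)%N -> (L + N < p)%N -> (M.+1 <= N.+1 ^ 2)%N ->
  (energy s (fun x : 'I_M.+1 * 'I_N.+1 =>
     (K + x.1)`!%:R * (L + x.2)`!%:R : 'F_p)%R)%:R <=
  ((fibre_const s)%:R * 2 ^+ (s + s) + 2) *
   (M.+1%:R ^+ (s + s).-1 * N.+1%:R ^+ (s + s) *
    (M.+1%:R `^ (1 / (2 * s%:R)) * N.+1%:R `^ (- (1 / (2 * s.+1%:R))))) :> R.
Proof.
move=> pr_p s_gt0 lt_pM lt_pN le_MN; set rho := _ `^ _ * _ `^ _.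
set m : R := M.+1%:R; set n : R := N.+1%:R.
have m_gt0 : 0 < m by rewrite ltr0n.
have n_gt0 : 0 < n by rewrite ltr0n.
have n_ge1 : 1 <= n by rewrite ler1n.
have s_ge1 : 1 <= s%:R :> R by rewrite ler1n.
have rho_gt0 : 0 < rho by rewrite mulr_gt0 ?powR_gt0.
pose w := shifted_fact p L N.
have w_neq0 j : w j != 0.
  by rewrite /w /shifted_fact fact_Fp_neq0 //; have := ltn_ord j; lia.
have le_E := factorial_product_energy_le _ K M (block R rho) s _ w pr_p s_gt0
  (block_gt0 R rho) lt_pM w_neq0.
rewrite card_ord in le_E.
apply: (balance_block R s 1 M.+1 N.+1 _ _ (fibre_const s)%:R _ rho _ _ rho_gt0 _ le_E).
- by [].
- by rewrite addn_gt0 s_gt0.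
- exact: ler0n.
- apply: sum_moments_le => //; first exact: block_gt0.
  (* From [M <= N^2] follows [rho <= N^(1/s - 1/(2(s+1)))], and [1/s <= 1/2] gives the required
     bound. *)
  move=> s_gt1; have s_ge2 : 2 <= s%:R :> R by rewrite (ler_nat _ 2).
  have a_gt0 : 0 < (s%:R + 1)^-1 :> R by rewrite invr_gt0; lra.
  have a_le : (s%:R + 1)^-1 <= 1 / 2 :> R by rewrite div1r lef_pV2 ?posrE; lra.
  have b_le : s%:R^-1 <= 1 / 2 :> R by rewrite div1r lef_pV2 ?posrE; lra.
  have Ea : 1 / (2 * s.+1%:R) = (s%:R + 1)^-1 / 2 :> R.
    by rewrite -natr1; field; rewrite gt_eqF //; lra.
  apply: block_le; first by rewrite -[X in X <= _](powRr0 n) ler_powR // Ea; lra.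
  rewrite ltW //=.
  apply: (@le_trans _ _ ((n ^+ 2) `^ (1 / (2 * s%:R)) * n `^ (- (1 / (2 * s.+1%:R))))).
    rewrite ler_wpM2r ?powR_ge0 // ge0_ler_powR ?nnegrE ?exprn_ge0 ?ler0n //.
      by rewrite divr_ge0 //; lra.
    by rewrite /m /n -natrX ler_nat.
  rewrite exprn_powR ?ler0n // -powRrM powR_mul_same // ler_powR // Ea.
  have -> : 2 * (1 / (2 * s%:R)) = s%:R^-1 :> R by field; rewrite gt_eqF //; lra.
  lra.
rewrite -exprSr (_ : (s + s - 1).+1 = s + s)%N; last by lia.
rewrite /rho -/m -/n exprMn !exprn_powR ?powR_ge0 ?ltW // -!powRrM -mulrA !powR_mul_same //.
rewrite natrD natr_doubleB1 // -[s.+1%:R]natr1; congr (_ * _).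
  by rewrite (_ : _ * _ = 1) ?powRr1 ?ltW //; field; rewrite gt_eqF //; lra.
by congr (_ `^ _); field; rewrite gt_eqF //; lra.
Qed.

End FactorialBounds.

(** * The deviation from the mean *)

Definition product_of_facts (p K M L N : nat) (x : 'I_M.+1 * 'I_N.+1) : 'F_p :=
  (K + x.1)`!%:R * (L + x.2)`!%:R.

(** Ordinals start at 0 and the ranges at [K + 1] and [L + 1], hence the offsets [K.+1] and
    [L.+1]. *)
Lemma factorial_sum_countE (p r K M L N : nat) (lambda : int) : prime p ->
  factorial_sum_count p r K M.+1 L N.+1 lambda =
  representations r (product_of_facts p K.+1 M L.+1 N) (lambda%:~R : 'F_p).
Proof.
move=> pr_p; rewrite /factorial_sum_count /representations.
pose phi (f : {ffun 'I_r -> 'I_M.+1 * 'I_N.+1}) :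
    {ffun 'I_r -> 'I_(K + M.+1).+1} * {ffun 'I_r -> 'I_(L + N.+1).+1} :=
  ([ffun i => inord (K.+1 + (f i).1)], [ffun i => inord (L.+1 + (f i).2)]).
have phi1 f i : ((phi f).1 i = K.+1 + (f i).1 :> nat)%N.
  by rewrite ffunE inordK //; have := ltn_ord (f i).1; lia.
have phi2 f i : ((phi f).2 i = L.+1 + (f i).2 :> nat)%N.
  by rewrite ffunE inordK //; have := ltn_ord (f i).2; lia.
have phi_inj : injective phi.
  move=> f1 f2 E; apply/ffunP => i.
  have := phi1 f1 i; have := phi2 f1 i; rewrite E phi1 phi2.
  case: (f1 i) (f2 i) => [a b] [c d] /= E2 E1.
  by congr (_, _); apply: val_inj => /=; lia.
rewrite -[RHS](card_imset _ phi_inj); congr #|pred_of_set _|; apply/setP => -[mm nn].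
have sumE (m n : 'I_r -> nat) :
    ((\sum_(i < r) ((n i)`! * (m i)`!)%N%:Z == lambda %[mod p])%Z) =
    (\sum_i (m i)`!%:R * (n i)`!%:R == lambda%:~R :> 'F_p).
  rewrite eqz_mod_dvd (dvdz_pcharf (pchar_Fp pr_p)) rmorphB subr_eq0 rmorph_sum /=.
  by congr (_ == _); apply: eq_bigr => i _; rewrite -pmulrn natrM mulrC.
rewrite inE; apply/and3P/imsetP => [[/forallP mm_ge /forallP nn_ge sum_eq]|[f]].
  pose f : {ffun 'I_r -> 'I_M.+1 * 'I_N.+1} :=
    [ffun i => (inord (mm i - K.+1), inord (nn i - L.+1))].
  have def_mm i : (K.+1 + (f i).1 = mm i)%N.
    by rewrite ffunE /= inordK; have := mm_ge i; have := ltn_ord (mm i);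
      move: (nat_of_ord (mm i)) => x; lia.
  have def_nn i : (L.+1 + (f i).2 = nn i)%N.
    by rewrite ffunE /= inordK; have := nn_ge i; have := ltn_ord (nn i);
      move: (nat_of_ord (nn i)) => x; lia.
  exists f.
    rewrite inE /product_of_facts; move: sum_eq; rewrite sumE.
    by under [in X in _ -> X]eq_bigr do rewrite def_mm def_nn.
  congr (_, _); apply/ffunP => i; apply: ord_inj.
    exact: (etrans (esym (def_mm i)) (esym (phi1 f i))).
  exact: (etrans (esym (def_nn i)) (esym (phi2 f i))).
rewrite inE => sum_eq [-> ->]; split.
- by apply/forallP => i; rewrite (phi1 f i) addn1 leq_addr.
- by apply/forallP => i; rewrite (phi2 f i) addn1 leq_addr.
rewrite sumE; move: sum_eq; rewrite /product_of_facts.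
by under [in X in _ -> X]eq_bigr do rewrite (phi1 f) (phi2 f).
Qed.

Lemma natr_dist (T : numDomainType) (a b : nat) :
  `|a%:R - b%:R| = (`|a%:Z - b%:Z|%N)%:R :> T.
Proof. by rewrite natr_absz intr_norm rmorphB /= -!pmulrn. Qed.

(** Characters take values in [algC], but the inequality compares natural numbers, so it passes
    through [nat] to [R]. *)
Lemma circle_method_factorials (R : realType) (p K M L N k l s t : nat) (x : 'F_p) :
  prime p -> (K + M < p)%N -> (L + N < p)%N ->
  `|p%:R * (representations (t + (s + s)) (product_of_facts p K M L N) x)%:R -
      (M.+1%:R * N.+1%:R) ^+ (t + (s + s))| ^+ (l.+1 * (k.+1 + k.+1)) <=
  ((M.+1%:R ^+ l) ^+ (k.+1 + k.+1) * (N.+1%:R ^+ l.+1) ^+ (k + k) *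
     (energy l.+1 (shifted_fact p L N))%:R *
     (p%:R * (energy k.+1 (shifted_fact p K M))%:R)) ^+ t *
  (p%:R * (energy s (product_of_facts p K M L N))%:R) ^+ (l.+1 * (k.+1 + k.+1)) :> R.
Proof.
move=> pr_p lt_pM lt_pN.
set r := (t + (s + s))%N; set u := product_of_facts _ _ _ _ _.
set T := representations r u _; set D := (l.+1 * _)%N.
pose B := ((M.+1 ^ l) ^ (k.+1 + k.+1) * (N.+1 ^ l.+1) ^ (k + k) *
     energy l.+1 (shifted_fact p L N) * (p * energy k.+1 (shifted_fact p K M)))%N.
have [e e_char] := exists_nontrivial_character p pr_p.
suff : `|(p * T)%:R - ((M.+1 * N.+1) ^ r)%:R| ^+ D <= (B ^ t * (p * energy s u) ^ D)%:R :> algC.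
  rewrite natr_dist -[X in X <= _]natrX ler_nat => le_B.
  move: le_B; rewrite -(ler_nat R) [X in X <= _]natrX -natr_dist.
  by rewrite /B !(natrM, natrX).
have cardF : #|'F_p| = p by rewrite card_Fp.
have := @circle_method _ e e_char _ u s t D x B%:R.
rewrite cardF card_prod !card_ord !(natrM, natrX); apply => //.
  by rewrite !mulr_ge0 ?exprn_ge0 ?ler0n.
move=> a a_neq0.
have := @bilinear_expsum_le _ e e_char _ _ (shifted_fact p K M) (shifted_fact p L N) k l a a_neq0.
by rewrite cardF !card_ord natrX.
Qed.

Lemma powR_expM (R : realType) (x y : R) (n : nat) : (x `^ y) ^+ n = x `^ (y * n%:R).
Proof. by rewrite exprn_powR ?powR_ge0 // powRrM. Qed.

Definition deviation_const (k l s t : nat) : nat :=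
  ((energy_const l * energy_const k) ^ t * (fibre_const s * 2 ^ (s + s) + 2))%N.

Lemma deviation_le (R : realType) (p K M L N k l s t : nat) (x : 'F_p) :
  prime p -> (0 < k)%N -> (0 < l)%N -> (0 < s)%N ->
  (K + M < p)%N -> (L + N < p)%N -> (M.+1 <= N.+1 ^ 2)%N ->
  `|(representations (t + (s + s)) (product_of_facts p K M L N) x)%:R -
      (M.+1%:R * N.+1%:R) ^+ (t + (s + s)) / p%:R| <=
  (deviation_const k l s t)%:R *
  ((M.+1%:R `^ (1 - 1 / (2 * l%:R * (k%:R + 1))) *
    N.+1%:R `^ (1 - 1 / (2 * k%:R * (l%:R + 1))) *
    p%:R `^ (1 / (2 * k%:R * l%:R))) ^+ t *
   (M.+1%:R ^+ (s + s).-1 * N.+1%:R ^+ (s + s) *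
    (M.+1%:R `^ (1 / (2 * s%:R)) * N.+1%:R `^ (- (1 / (2 * s.+1%:R)))))) :> R.
Proof.
(* The bilinear estimate is stated for successors; in terms of the original [k] and [l], [D] is
   [2kl]. *)
move=> pr_p; case: k => // k _; case: l => // l _ s_gt0 lt_pM lt_pN le_MN.
have p_gt0 : 0 < p%:R :> R by rewrite ltr0n prime_gt0.
have := circle_method_factorials R p K M L N k l s t x pr_p lt_pM lt_pN.
have := factorial_product_energy_bound R p K M L N s pr_p s_gt0 lt_pM lt_pN le_MN.
have := factorial_energy_bound R p L N l.+1 pr_p isT lt_pN.
have := factorial_energy_bound R p K M k.+1 pr_p isT lt_pM.
rewrite -/(shifted_fact p K M) -/(shifted_fact p L N) -/(product_of_facts p K M L N).
set m : R := M.+1%:R; set n : R := N.+1%:R.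
set Ek : R := (energy k.+1 _)%:R; set El : R := (energy l.+1 _)%:R.
set Es : R := (energy s _)%:R; set T := (representations _ _ _)%:R.
set r := (t + (s + s))%N; set D := (_ * _)%N.
set bound := _ * (m `^ (1 / _) * _).
set beta := _ * _ * p%:R `^ _.
move=> Ek_le El_le Es_le main.
have m_gt0 : 0 < m by rewrite ltr0n.
have n_gt0 : 0 < n by rewrite ltr0n.
have beta_ge0 : 0 <= beta by rewrite !mulr_ge0 ?powR_ge0.
have bound_ge0 : 0 <= bound by rewrite !mulr_ge0 ?exprn_ge0 ?powR_ge0 ?ltW.
have D_gt0 : (0 < D)%N by [].
pose C1 : R := (energy_const l.+1)%:R * (energy_const k.+1)%:R.
have C1_ge1 : 1 <= C1.
  by rewrite /C1 -natrM ler1n muln_gt0 /energy_const !addn_gt0 !orbT.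
have C1_ge0 : 0 <= C1 by apply: le_trans C1_ge1.
have E_ge0 : [/\ 0 <= Ek, 0 <= El & 0 <= Es] by split; rewrite ler0n.
case: E_ge0 => Ek_ge0 El_ge0 Es_ge0.
(* Up to the constant [C1], [beta] is the bound for the exponential sum at nonzero frequencies. *)
have bil_le : (m ^+ l) ^+ (k.+1 + k.+1) * (n ^+ l.+1) ^+ (k + k) * El * (p%:R * Ek) <=
    C1 * beta ^+ D.
  apply: (@le_trans _ _ ((m ^+ l) ^+ (k.+1 + k.+1) * (n ^+ l.+1) ^+ (k + k) *
     ((energy_const l.+1)%:R * (n ^+ (l.+1 + l.+1).-1 * n `^ (l.+2%:R)^-1)) *
     (p%:R * ((energy_const k.+1)%:R * (m ^+ (k.+1 + k.+1).-1 * m `^ (k.+2%:R)^-1))))).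
    by rewrite ler_pM ?mulr_ge0 ?exprn_ge0 ?(ltW m_gt0) ?(ltW n_gt0) ?ler0n //
      ler_wpM2l ?mulr_ge0 ?exprn_ge0 ?(ltW m_gt0) ?(ltW n_gt0) ?ler0n.
  rewrite le_eqVlt; apply/orP; left; apply/eqP.
  have -> : beta ^+ D =
    (m ^+ (l * (k.+1 + k.+1)) * (m ^+ (k.+1 + k.+1).-1 * m `^ (k.+2%:R)^-1)) *
    (n ^+ (l.+1 * (k + k)) * (n ^+ (l.+1 + l.+1).-1 * n `^ (l.+2%:R)^-1)) * p%:R.
    have k_ge0 : 0 <= k%:R :> R by [].
    have l_ge0 : 0 <= l%:R :> R by [].
    rewrite /beta !exprMn !powR_expM /D !exprn_powR ?ltW // !powR_mul_same //.
    rewrite !natr_doubleB1 // !natrM !natrD -[k.+2%:R]natr1 -[l.+2%:R]natr1.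
    rewrite -[k.+1%:R]natr1 -[l.+1%:R]natr1.
    congr (_ * _ * _).
    - by congr (_ `^ _); field; apply/andP; split; rewrite gt_eqF //; lra.
    - by congr (_ `^ _); field; apply/andP; split; rewrite gt_eqF //; lra.
    - rewrite -[RHS]powRr1 ?ltW //.
      by congr (_ `^ _); field; apply/andP; split; rewrite gt_eqF //; lra.
  by rewrite /C1 !exprM; ring.
rewrite -(ler_pXn2r D_gt0) ?nnegrE //; last first.
  by rewrite mulr_ge0 ?ler0n // mulr_ge0 ?exprn_ge0.
apply: (@le_trans _ _ ((C1 * beta ^+ D) ^+ t * Es ^+ D)).
  have -> : T - (m * n) ^+ r / p%:R = (p%:R * T - (m * n) ^+ r) / p%:R.
    by field; rewrite gt_eqF.
  rewrite normrM exprMn normfV (ger0_norm (ltW p_gt0)) exprVn.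
  rewrite ler_pdivrMr ?exprn_gt0 //; apply: le_trans main _.
  rewrite [(p%:R * Es) ^+ D]exprMn [leLHS]mulrCA [leRHS]mulrC ler_wpM2l ?exprn_ge0 ?ler0n //.
  rewrite ler_wpM2r ?exprn_ge0 // lerXn2r ?nnegrE //; last by rewrite mulr_ge0 ?exprn_ge0.
  by rewrite ?(mulr_ge0, exprn_ge0) // ?ltW.
have const_E : (deviation_const k.+1 l.+1 s t)%:R =
    C1 ^+ t * ((fibre_const s)%:R * 2 ^+ (s + s) + 2) :> R.
  by rewrite /deviation_const natrM natrX natrM natrD natrM natrX.
clearbody beta bound C1.
rewrite const_E [X in _ <= X ^+ _](_ : _ = C1 ^+ t * beta ^+ t *
  (((fibre_const s)%:R * 2 ^+ (s + s) + 2) * bound)); last by ring.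
rewrite !exprMn -/D [(beta ^+ t) ^+ D]exprAC.
rewrite -[leLHS]mulrA -[leRHS]mulrA ler_pM ?mulr_ge0 ?exprn_ge0 //.
  (* As [C1 >= 1], its [t]-th power is at most the [D]-th power of itself. *)
  by rewrite ler_eXnr // exprn_ege1.
rewrite ler_wpM2l ?exprn_ge0 // -exprMn lerXn2r ?nnegrE //.
by apply: le_trans Es_le.
Qed.

Theorem theorem5 (R : realType) (k l r s : nat)
    (hk : (0 < k)%N) (hl : (0 < l)%N) (hr : (0 < r)%N) (hs : (0 < s)%N)
    (hsr : s%:R <= r%:R / 2 :> R) :
  exists2 c : R, 0 < c &
    forall (p K L M N : nat) (lambda : int),
      prime p -> odd p ->
      (K < K + M < p)%N -> (L < L + N < p)%N ->
      (M <= N ^ 2)%N -> Num.sqrt (N%:R : R) <= M%:R ->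
      `| (factorial_sum_count p r K M L N lambda)%:R
           - (M%:R * N%:R) ^+ r / p%:R |
      <= c
         * M%:R `^ (r%:R - 1 + 1 / (2 * s%:R)
                    - (r%:R - 2 * s%:R) / (2 * l%:R * (k%:R + 1)))
         * N%:R `^ (r%:R - 1 / (2 * (s%:R + 1))
                    - (r%:R - 2 * s%:R) / (2 * k%:R * (l%:R + 1)))
         * p%:R `^ ((r%:R - 2 * s%:R) / (2 * k%:R * l%:R)).
Proof.
have le_sr : (s + s <= r)%N.
  by rewrite -(ler_nat R) natrD; lra.
pose t := (r - (s + s))%N.
have def_r : r = (t + (s + s))%N by rewrite subnK.
exists (deviation_const k l s t)%:R.
  by rewrite ltr0n /deviation_const muln_gt0 expn_gt0 muln_gt0 /energy_const !addn_gt0 !orbT.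
(* The strict inequalities exclude [M = 0] and [N = 0], so both lengths are successors. *)
move=> p K L M N lambda pr_p _ /andP[]; case: M => [|M]; first by rewrite addn0 ltnn.
move=> _ lt_pM /andP[]; case: N => [|N]; first by rewrite addn0 ltnn.
move=> _ lt_pN le_MN _.
rewrite factorial_sum_countE // def_r.
apply: le_trans (deviation_le R p K.+1 M L.+1 N k l s t _ pr_p hk hl hs _ _ le_MN) _; try lia.
have m_gt0 : 0 < M.+1%:R :> R by rewrite ltr0n.
have n_gt0 : 0 < N.+1%:R :> R by rewrite ltr0n.
have p_gt0 : 0 < p%:R :> R by rewrite ltr0n prime_gt0.
have [k_gt0 l_gt0 s_gt0] : [/\ 0 < k%:R :> R, 0 < l%:R :> R & 0 < s%:R :> R].
  by rewrite !ltr0n.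
rewrite -!mulrA ler_wpM2l ?ler0n //.
move: (M.+1%:R : R) (N.+1%:R : R) m_gt0 n_gt0 => m n m_gt0 n_gt0.
rewrite !exprMn !powR_expM !exprn_powR ?(ltW m_gt0) ?(ltW n_gt0) //.
rewrite natr_doubleB1 // -[s.+1%:R]natr1 !natrD.
have -> (a b c d f g h : R) : a * (b * c) * (d * (f * (g * h))) = a * d * g * (b * f * h * c).
  by ring.
(* With [t = r - 2s] the exponents on both sides agree exactly. *)
rewrite !powR_mul_same // le_eqVlt; apply/orP; left; apply/eqP.
by congr (_ `^ _ * (_ `^ _ * _ `^ _)); field; rewrite ?gt_eqF //; lra.
Qed.
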